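(* Let $G$ be a non-archimedean Polish group. Then the greatest ambit $S(G)$ is isomorphic as a $G$-space to the inverse limit of an inverse system (over a directed set, with continuous equivariant bonding maps) of compact metrizable zero-dimensional $G$-spaces. If moreover $G$ is infinite, there exists such an inverse system in which every $G$-space is homeomorphic to the Cantor space $\{0,1\}^{\mathbb N}$.
   Context: A Polish group is a separable completely metrizable topological group. A topological group is non-archimedean if it is Hausdorff and has a neighbourhood base at the identity consisting of open subgroups. The greatest ambit $S(G)$ is the Gelfand spectrum of the C*-algebra $RUCB(G)$ of bounded right uniformly continuous complex functions on $G$, with the continuous $G$-action $(g\cdot\varphi)(x)=\varphi(g^{-1}\cdot x)$ where $(g\cdot x)(h)=x(g^{-1}h)$. A $G$-space is a space with a continuous $G$-action; zero-dimensional means Lebesgue covering dimension $0$. *)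

(* Defs.v *)
From HB Require Import structures.
From mathcomp Require Import all_boot all_order all_algebra.
From mathcomp Require Import all_classical all_reals all_analysis.
From mathcomp Require Import complex Rstruct Rstruct_topology.
Import Order.TTheory GRing.Theory Num.Theory.
Import numFieldTopology.Exports.

Set Implicit Arguments.
Unset Strict Implicit.
Unset Printing Implicit Defensive.

Local Open Scope classical_set_scope.
Local Open Scope ring_scope.

(** Real numbers (Stdlib reals, a realType) and complex numbers R[i],
    the latter with the topology of its (complex) modulus. *)
Notation RR := Rdefinitions.R.
Definition CC : numClosedFieldType := RR[i].

Record topGroup := TopGroup {
  tg_car :> topologicalType;
  tg_mul : tg_car -> tg_car -> tg_car;
  tg_inv : tg_car -> tg_car;
  tg_one : tg_car;
  tg_mulA : forall x y z, tg_mul x (tg_mul y z) = tg_mul (tg_mul x y) z;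
  tg_mul1g : forall x, tg_mul tg_one x = x;
  tg_mulVg : forall x, tg_mul (tg_inv x) x = tg_one;
  tg_mul_cont : continuous (fun p : tg_car * tg_car => tg_mul p.1 p.2);
  tg_inv_cont : continuous tg_inv }.

Arguments tg_mul {_}.
Arguments tg_inv {_}.
Arguments tg_one {_}.

Definition metric_for (T : topologicalType) (d : T -> T -> RR) : Prop :=
  [/\ (forall x y, 0 <= d x y),
      (forall x y, d x y = 0 <-> x = y),
      (forall x y, d x y = d y x),
      (forall x y z, d x z <= d x y + d y z) &
      (forall A : set T, open A <->
         (forall x, A x -> exists2 e : RR, 0 < e & [set y | d x y < e] `<=` A))].

Definition metrizable (T : topologicalType) : Prop :=
  exists d : T -> T -> RR, metric_for d.

Definition d_cauchy (T : Type) (d : T -> T -> RR) (u : nat -> T) : Prop :=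
  forall e : RR, 0 < e -> exists N : nat,
    forall m n : nat, (N <= m)%N -> (N <= n)%N -> d (u m) (u n) < e.

Definition completely_metrizable (T : topologicalType) : Prop :=
  exists d : T -> T -> RR, metric_for d /\
    (forall u : nat -> T, d_cauchy d u -> exists x : T, u @ \oo --> x).

Definition separable_space (T : topologicalType) : Prop :=
  exists D : set T, countable D /\ closure D = [set: T].

Definition polish_space (T : topologicalType) : Prop :=
  separable_space T /\ completely_metrizable T.

Definition polish_group (G : topGroup) : Prop := polish_space G.

Definition open_subgroup (G : topGroup) (H : set G) : Prop :=
  [/\ open H, H tg_one,
      (forall x y, H x -> H y -> H (tg_mul x y)) &
      (forall x, H x -> H (tg_inv x))].

Definition non_archimedean (G : topGroup) : Prop :=
  hausdorff_space G /\
  (forall U : set G, nbhs tg_one U ->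
     exists H : set G, open_subgroup H /\ H `<=` U).

Definition is_gaction (G : topGroup) (X : topologicalType) (a : G -> X -> X)
  : Prop :=
  [/\ (forall x, a tg_one x = x),
      (forall g h x, a (tg_mul g h) x = a g (a h x)) &
      continuous (fun p : G * X => a p.1 p.2)].

(** ** Lebesgue covering dimension 0: the space is nonempty (dim of the empty
    space is -1) and every finite open cover has a finite open refinement
    of order <= 1 (i.e. consisting of pairwise disjoint sets). *)
Definition covering_dim_zero (X : topologicalType) : Prop :=
  [set: X] !=set0 /\
  forall (n : nat) (U : 'I_n -> set X),
    (forall k, open (U k)) -> (forall x, exists k, U k x) ->
    exists (m : nat) (V : 'I_m -> set X),
      [/\ (forall k, open (V k)),
          (forall x, exists k, V k x),
          (forall k, exists k', V k `<=` U k') &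
          (forall k k', k != k' -> V k `&` V k' = set0)].

Definition homeomorphic (X Y : topologicalType) : Prop :=
  exists (h : X -> Y) (k : Y -> X),
    [/\ cancel h k, cancel k h, continuous h & continuous k].

(** ** The C*-algebra RUCB(G) of bounded right uniformly continuous complex
    functions.  Right uniform continuity is w.r.t. the right uniformity
    {(x,y) | y x^-1 in V}: this is exactly the condition making the
    translation action (g.f)(h) = f(g^-1 h) continuous in sup norm. *)
Definition rucb (G : topGroup) (f : G -> CC) : Prop :=
  (exists M : CC, forall x, `|f x| <= M) /\
  (forall e : CC, 0 < e -> exists V : set G, nbhs tg_one V /\
     forall g x, V g -> `|f (tg_mul g x) - f x| < e).

Definition RUCB (G : topGroup) := {f : G -> CC | rucb f}.

Section Translation.
Variable G : topGroup.

Lemma tg_conj_cont (g : G) :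
  continuous (fun v : G => tg_mul (tg_mul g v) (tg_inv g)).
Proof.
move=> v.
have mc := @tg_mul_cont G.
have h1 : continuous (fun w : G => tg_mul g w).
  move=> w; apply: (continuous_comp (f := fun w : G => (g, w))
                      (g := fun p : G * G => tg_mul p.1 p.2)); last exact: mc.
  by apply: cvg_pair; [exact: cvg_cst | exact: cvg_id].
have h2 : continuous (fun w : G => tg_mul w (tg_inv g)).
  move=> w; apply: (continuous_comp (f := fun w : G => (w, tg_inv g))
                      (g := fun p : G * G => tg_mul p.1 p.2)); last exact: mc.
  by apply: cvg_pair; [exact: cvg_id | exact: cvg_cst].
exact: (continuous_comp (h1 v) (h2 _)).
Qed.

Lemma tg_mulgV (y : G) : tg_mul y (tg_inv y) = tg_one.
Proof.
rewrite -[LHS]tg_mul1g -(tg_mulVg (tg_inv y)) -tg_mulA.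
by rewrite [tg_mul (tg_inv y) _]tg_mulA tg_mulVg tg_mul1g tg_mulVg.
Qed.

Lemma tg_mulg1 (x : G) : tg_mul x tg_one = x.
Proof. by rewrite -(tg_mulVg x) tg_mulA tg_mulgV tg_mul1g. Qed.

Lemma rucb_translate (g : G) (f : G -> CC) :
  rucb f -> rucb (fun h => f (tg_mul g h)).
Proof.
case=> [[M hM] huc]; split; first by exists M => x; exact: hM.
move=> e e0; have [V [nV hV]] := huc e e0.
exists ((fun v : G => tg_mul (tg_mul g v) (tg_inv g)) @^-1` V); split.
  have c1 := @tg_conj_cont g tg_one.
  have e1 : tg_mul (tg_mul g tg_one) (tg_inv g) = tg_one.
    by rewrite tg_mulg1 tg_mulgV.
  by apply: c1; rewrite e1.
move=> v x Vv /=.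
have := hV _ (tg_mul g x) Vv.
suff -> : tg_mul (tg_mul (tg_mul g v) (tg_inv g)) (tg_mul g x)
          = tg_mul g (tg_mul v x) by [].
by rewrite -!tg_mulA [tg_mul (tg_inv g) _]tg_mulA tg_mulVg tg_mul1g.
Qed.

(** g^-1 . f, i.e. h |-> f (g h), as an element of RUCB(G). *)
Definition rucb_ltrans (g : G) (f : RUCB G) : RUCB G :=
  exist _ (fun h => sval f (tg_mul g h)) (rucb_translate g (svalP f)).

End Translation.

(** ** The greatest ambit S(G): the Gelfand spectrum of RUCB(G), i.e. the set
    of nonzero algebra homomorphisms RUCB(G) -> C (characters), as a subspace
    of C^RUCB(G) with the pointwise (weak-star) topology. *)
Definition ambit_space (G : topGroup) := {ptws RUCB G -> CC}.

Definition is_character (G : topGroup) (phi : ambit_space G) : Prop :=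
  [/\ (forall f g h : RUCB G, sval h = (fun x => sval f x + sval g x) ->
          phi h = phi f + phi g),
      (forall (c : CC) (f h : RUCB G), sval h = (fun x => c * sval f x) ->
          phi h = c * phi f),
      (forall f g h : RUCB G, sval h = (fun x => sval f x * sval g x) ->
          phi h = phi f * phi g) &
      (exists f : RUCB G, phi f != 0)].

Definition greatest_ambit (G : topGroup) : set (ambit_space G) :=
  [set phi | is_character phi].
Arguments greatest_ambit : clear implicits.

(** The action on S(G): (g.phi)(f) = phi(g^-1 . f). *)
Definition ambit_act (G : topGroup) (g : G) (phi : ambit_space G)
  : ambit_space G := fun f => phi (rucb_ltrans g f).

Definition gspace_inverse_system (G : topGroup) (I : Type)
    (le : I -> I -> Prop) (X : I -> topologicalType)
    (act : forall i, G -> X i -> X i)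
    (bond : forall i j, X j -> X i) : Prop :=
  [/\
      [/\ inhabited I,
           (forall i, le i i),
           (forall i j k, le i j -> le j k -> le i k) &
           (forall i j, exists k, le i k /\ le j k)],
      (forall i, is_gaction (act i)),
      (forall i j, le i j -> continuous (bond i j) /\
         forall g x, bond i j (act j g x) = act i g (bond i j x)) &
      (forall i x, bond i i x = x) /\
      (forall i j k, le i j -> le j k -> forall x,
         bond i j (bond j k x) = bond i k x)].

Definition inverse_limit (I : Type) (le : I -> I -> Prop)
    (X : I -> topologicalType) (bond : forall i j, X j -> X i)
  : set (prod_topology X) :=
  [set x | forall i j, le i j -> bond i j (x j) = x i].

Definition limit_act (G : topGroup) (I : Type) (X : I -> topologicalType)
    (act : forall i, G -> X i -> X i) (g : G) (x : prod_topology X)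
  : prod_topology X := fun i => act i g (x i).

Definition ambit_iso_limit (G : topGroup) (I : Type) (le : I -> I -> Prop)
    (X : I -> topologicalType) (act : forall i, G -> X i -> X i)
    (bond : forall i j, X j -> X i) : Prop :=
  exists (Phi : ambit_space G -> prod_topology X)
         (Psi : prod_topology X -> ambit_space G),
    [/\ [/\ (forall phi, greatest_ambit G phi -> inverse_limit le bond (Phi phi)),
        (forall x, inverse_limit le bond x -> greatest_ambit G (Psi x)),
        (forall phi, greatest_ambit G phi -> Psi (Phi phi) = phi) &
        (forall x, inverse_limit le bond x -> Phi (Psi x) = x)],
        {within greatest_ambit G, continuous Phi},
        {within inverse_limit le bond, continuous Psi} &
        (forall g phi, greatest_ambit G phi ->
           Phi (ambit_act g phi) = limit_act act g (Phi phi))].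

(* Main.v *)
(** Since [G] is non-archimedean, RUCB(G) is generated by the indicators of the
    sets [A] with [V A = A] for some neighbourhood [V] of the identity, so S(G) is
    the space of ultrafilters on the Boolean algebra of these sets: a character
    [phi] corresponds to the ultrafilter of all [A] with [phi 1_A = 1], and is
    recovered as the limit of functions along it. Such an [A] has an open
    stabilizer, hence a countable [G]-orbit as [G] is separable. Restricting
    ultrafilters to countable [G]-invariant families [F] gives compact metrizable
    zero-dimensional [G]-spaces [K_F], with limit S(G) over all [F].

    The product of [K_F] with the Cantor space [C] is again a Cantor space by
    Brouwer's theorem. Bonding maps need not be onto, so one may let [G] act
    trivially on [C] and collapse [C] to a point along all bonds
    [(F, n) < (F', m)] with [n < m]: this leaves the limit unchanged, and every
    space of the system is a Cantor space. *)
Require Import Defs.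
From HB Require Import structures.
From mathcomp Require Import all_boot all_order all_algebra.
From mathcomp Require Import all_classical all_reals all_analysis.
From mathcomp Require Import cantor complex Rstruct Rstruct_topology.
Import Order.TTheory GRing.Theory Num.Theory.
Import numFieldTopology.Exports.
Import numFieldNormedType.Exports.
Set Implicit Arguments.
Unset Strict Implicit.
Unset Printing Implicit Defensive.
Local Open Scope classical_set_scope.

(** * General facts on compactness and convergence *)

Lemma initial_compact (S : choiceType) (T : topologicalType) (f : S -> T) :
  compact (range f) -> compact [set: initial_topology f].
Proof.
move=> cf F FF _.
have fF : (f @ F) (range f).
  by apply: (@filterS _ F _ setT); [move=> x _; exists x|exact: filterT].
have [y [[s _ <-] Fs]] := cf (f @ F) _ fF.
exists s; split=> // A U FA [_ [[W oW <-] Ws WU]].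
have fA : (f @ F) (f @` A) by apply: (@filterS _ F _ A) FA => x Ax; exists x.
have [|_ [[a Aa <-] Wa]] := Fs _ W fA; first by apply: open_nbhs_nbhs; split.
by exists a; split=> //; exact: WU.
Qed.

Lemma prod_coord_cvg (I : Type) (T : I -> topologicalType) (S : Type)
    (F : set_system S) (f : S -> prod_topology T) (p : prod_topology T) :
  Filter F -> (forall i, f s i @[s --> F] --> p i) -> f @ F --> p.
Proof.
move=> FF h; apply/cvg_sup => i U [_ [[W oW <-] Wp WU]].
have /h FW : nbhs (p i) W by apply: open_nbhs_nbhs; split.
have {}FW : F ((f ^~ i) @^-1` W) by [].
suff : F (f @^-1` U) by [].
by apply: filterS FW => s; exact: WU.
Qed.

Lemma prod_coord_continuous (I : Type) (T : I -> topologicalType) (i : I) :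
  continuous (fun p : prod_topology T => p i).
Proof. exact: (@proj_continuous {classic I}). Qed.

(** A continuous injection of a compact space into a Hausdorff space is a closed map, hence an
    embedding, so convergence can be tested after applying [J]. *)
Lemma continuous_inj_cvg (X Y : topologicalType) (S : Type)
    (F : set_system S) (J : X -> Y) (f : S -> X) (x : X) :
  compact [set: X] -> hausdorff_space Y -> continuous J -> injective J ->
  Filter F -> J \o f @ F --> J x -> f @ F --> x.
Proof.
move=> cX hY cJ iJ FF h U; rewrite nbhsE => -[V [oV Vx] VU].
have cJV : closed (J @` (~` V)).
  apply: compact_closed => //; apply: continuous_compact.
    exact: continuous_subspaceT.
  by apply: (subclosed_compact _ cX) => //; exact: open_closedC.
have /h FJ : nbhs (J x) (~` (J @` (~` V))).
  apply: open_nbhs_nbhs; split; first exact: closed_openC.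
  by case=> y nVy /iJ yx; apply: nVy; rewrite yx.
have {}FJ : F ((J \o f) @^-1` (~` (J @` (~` V)))) by [].
suff : F (f @^-1` U) by [].
apply: filterS FJ => s /= nJ; apply: VU; apply: contrapT => nV.
by apply: nJ; exists (f s).
Qed.

(** Reduces Hausdorffness, in its cluster form, to separate coordinates with Hausdorff targets. *)
Lemma cluster_continuous_eq (X Y : topologicalType) (p : X -> Y) (x x' : X) :
  hausdorff_space Y -> continuous p -> cluster (nbhs x) x' -> p x = p x'.
Proof.
move=> hY cp xx'; apply: hY => A B nA nB.
by have [z [Az Bz]] := xx' _ _ (cp _ _ nA) (cp _ _ nB); exists (p z).
Qed.

Lemma cvg_to_pair (X Y : topologicalType) (S : Type) (F : set_system S)
    (f : S -> X) (g : S -> Y) (x : X) (y : Y) :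
  Filter F -> f @ F --> x -> g @ F --> y -> (f s, g s) @[s --> F] --> (x, y).
Proof. by move=> FF; exact: cvg_pair. Qed.

(** * Products of compact zero-dimensional sets with the Cantor space *)

Section prod_perfect.
Variables (Z : pseudoMetricType RR) (L : set Z) (l0 : Z).
Hypotheses (Ll0 : L l0) (cL : compact L) (hZ : hausdorff_space Z)
  (zZ : zero_dimensional Z).
Let CM : pseudoMetricType RR := prod_topology (fun _ : nat => bool).
Let T := set_type (L `*` [set: CM]).
Let t0 : T := exist _ (l0, (fun=> false) : CM) (mem_set (conj Ll0 I)).

Let val_cont : continuous (fun t : T => val t : Z * CM).
Proof. exact: initial_continuous. Qed.

Let T_compact : compact [set: T].
Proof.
apply: initial_compact.
have -> : range (set_val : T -> Z * CM) = L `*` [set: CM].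
  rewrite eqEsubset; split=> [_ [[z /= /set_mem Lz] _ <-]//|z Lz].
  by exists (exist _ z (mem_set Lz)).
by apply: compact_setX => //; exact: cantor_space_compact.
Qed.

Let val_sep (t u : T) : t != u ->
  (val t).1 != (val u).1 \/ (val t).2 != (val u).2.
Proof.
move=> tu; apply/orP; rewrite -negb_and; apply: contra tu => /andP[/eqP e1 /eqP e2].
by apply/eqP/val_inj; rewrite [LHS]surjective_pairing e1 e2 -surjective_pairing.
Qed.

Let pr1_cont : continuous (fun t : T => (val t).1).
Proof. by move=> t; apply: cvg_comp (@val_cont t) _; exact: cvg_fst. Qed.

Let pr2_cont : continuous (fun t : T => (val t).2).
Proof. by move=> t; apply: cvg_comp (@val_cont t) _; exact: cvg_snd. Qed.

Let T_hausdorff : hausdorff_space T.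
Proof.
move=> t u tu; apply/eqP; apply: contrapT => /negP /val_sep[]/eqP; apply.
  exact: cluster_continuous_eq pr1_cont tu.
by apply: cluster_continuous_eq pr2_cont tu; exact: cantor_space_hausdorff.
Qed.

Let T_zero_dimensional : zero_dimensional T.
Proof.
move=> t u /val_sep[/zZ|/cantor_zero_dimensional] [U [cU Ut Uu]].
  by exists ((fun t : T => (val t).1) @^-1` U); split=> //; exact: preimage_clopen.
by exists ((fun t : T => (val t).2) @^-1` U); split=> //; exact: preimage_clopen.
Qed.

(** If [(z, c)] were isolated, pulling back along the slice [j] through [z] would make [c] isolated
    in the Cantor space. *)
Let T_perfect : perfect_set [set: T].
Proof.
apply/perfectTP => -[[z c] zc] ot.
have Lz : L z by have [] := set_mem zc.
pose j (d : CM) : T := exist _ (z, d) (mem_set (conj Lz I : (L `*` [set: CM]) (z, d))).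
have jc : continuous j.
  apply: continuous_comp_initial => d.
  by apply: cvg_to_pair; [exact: cvg_cst|exact: cvg_id].
have := (perfectTP.1 cantor_perfect) c; apply.
suff -> : [set c] = j @^-1` [set exist _ (z, c) zc].
  by apply: open_comp ot => d _; exact: jc.
rewrite eqEsubset; split=> [d -> /=|d /= /(congr1 (snd \o val))//].
exact: val_inj.
Qed.

(** Brouwer's characterization applies to the subspace [T]. Composing with the inclusion gives an
    injection of prescribed range into the ambient product, so that the subspace type need not be
    handled again. *)
Lemma cantor_prod_param : exists J : cantor_space -> Z * cantor_space,
  [/\ continuous J, injective J & range J = L `*` [set: cantor_space]].
Proof.
pose TP : pseudoPMetricType RR := HB.pack (set_type (L `*` [set: CM]))
  (isPointed.Build (set_type (L `*` [set: CM])) t0).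
have [] := @homeomorphism_cantor_like RR TP; first by split.
move=> f [cf _]; exists (fun c => val (f c)); split.
- by move=> c; apply: cvg_comp (cf c) (@val_cont _).
- move=> c d /val_inj /(congr1 (f^-1)%FUN).
  by rewrite !funK ?inE.
- rewrite eqEsubset; split=> [_ [c _ <-]|z Lz].
    exact: set_mem (valP (f c)).
  exists ((f^-1)%FUN (exist _ z (mem_set Lz))) => //=.
  by rewrite invK ?inE.
Qed.

End prod_perfect.

(** * The Cantor space *)

Definition cylinder (n : nat) (x : cantor_space) : set cantor_space :=
  [set y | forall i, (i < n)%N -> y i = x i].

Lemma cylinder_nbhs n x : nbhs x (cylinder n x).
Proof.
elim: n => [|n IHn]; first by apply: filterS filterT => y _ i.
have nx : nbhs x [set y : cantor_space | y n = x n].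
  by have := @prod_coord_continuous nat (fun=> bool) n x _ (discrete_set1 (x n)).
apply: filterS (filterI IHn nx) => y [yx ynx] i.
by rewrite ltnS leq_eqVlt => /predU1P[->//|/yx].
Qed.

Lemma nbhs_cylinder x (U : set cantor_space) :
  nbhs x U -> exists n, cylinder n x `<=` U.
Proof.
(* The filter generated by the cylinders at [x] converges to [x] in each coordinate, hence in the
   product, so it contains every neighbourhood of [x]. *)
pose F := filter_from [set: nat] (cylinder ^~ x).
have FF : Filter F.
  apply: filter_from_filter; first by exists 0%N.
  move=> m n _ _; exists (maxn m n) => // y yx.
  by split=> i im; apply: yx; rewrite leq_max im ?orbT.
have Fx : id @ F --> (x : prod_topology (fun=> bool)).
  apply: prod_coord_cvg => i A Ax; exists i.+1 => // y /(_ i (ltnSn i)) /= ->.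
  exact: nbhs_singleton.
by move=> /Fx [n _ nU]; exists n.
Qed.

Definition cantor_dist (x y : cantor_space) : RR :=
  if pselect (exists n, x n != y n) is left h then ((ex_minn h).+1%:R^-1)%R else 0%R.

Lemma cantor_dist_ge x y n : x n <> y n -> (n.+1%:R^-1 <= cantor_dist x y)%R.
Proof.
move=> xy; rewrite /cantor_dist; case: pselect => [h|[]]; last by exists n; apply/eqP.
case: ex_minnP => k _ /(_ n) kn.
by rewrite lef_pV2 ?posrE ?ltr0n// ler_nat ltnS kn//; apply/eqP.
Qed.

Lemma cantor_dist_lt x y n :
  cylinder n.+1 x y -> (cantor_dist x y < n.+1%:R^-1)%R.
Proof.
move=> xy; rewrite /cantor_dist; case: pselect => [h|_]; last by rewrite invr_gt0 ltr0n.
case: ex_minnP => k kxy _.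
rewrite ltf_pV2 ?posrE ?ltr0n// ltr_nat ltnS ltnNge; apply: contra kxy => kn.
by rewrite xy.
Qed.

Lemma cantor_distxx x : cantor_dist x x = 0%R.
Proof. by rewrite /cantor_dist; case: pselect => // h; have [n] := h; rewrite eqxx. Qed.

Lemma cantor_dist_neq x y : x <> y ->
  exists2 n, x n <> y n & cantor_dist x y = (n.+1%:R^-1)%R.
Proof.
move=> xy; rewrite /cantor_dist; case: pselect => [h|nh].
  by case: ex_minnP => k /eqP kxy _; exists k.
exfalso; apply: xy; apply: functional_extensionality_dep => n.
by apply: contrapT => /eqP ?; apply: nh; exists n.
Qed.

Lemma cantor_dist_ge0 x y : (0 <= cantor_dist x y)%R.
Proof. by rewrite /cantor_dist; case: pselect. Qed.

Lemma cantor_metrizable : metrizable cantor_space.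
Proof.
exists cantor_dist; split.
- exact: cantor_dist_ge0.
- move=> x y; split=> [d0|->]; last exact: cantor_distxx.
  apply: contrapT => /cantor_dist_neq[n _]; rewrite d0 => /esym/eqP.
  by rewrite invr_eq0 pnatr_eq0.
- have H x y : (cantor_dist x y <= cantor_dist y x)%R.
    have [->//|/cantor_dist_neq[n xy ->]] := pselect (x = y).
    by apply: cantor_dist_ge; exact: nesym.
  by move=> x y; apply/eqP; rewrite eq_le !H.
- move=> x y z; have [->|/cantor_dist_neq[n xz ->]] := pselect (x = z).
    by rewrite cantor_distxx addr_ge0 ?cantor_dist_ge0.
  (* At the first [n] where [x] and [z] differ, [y] differs from one of them, so one summand alone
     is at least $1/(n+1)$. *)
  have [xy|xy] := pselect (x n = y n).
    apply: (@le_trans _ _ (cantor_dist y z)); last by rewrite lerDr cantor_dist_ge0.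
    by apply: cantor_dist_ge; rewrite -xy.
  apply: (@le_trans _ _ (cantor_dist x y)); last by rewrite lerDl cantor_dist_ge0.
  exact: cantor_dist_ge.
- move=> A; split=> [oA x Ax|hA].
    have [n nA] := nbhs_cylinder (open_nbhs_nbhs (conj oA Ax)).
    exists (n.+1%:R^-1)%R; first by rewrite invr_gt0 ltr0n.
    move=> y /= dxy; apply: nA => i ilt; apply: contrapT => /nesym/cantor_dist_ge.
    move/(le_lt_trans)/(_ dxy); rewrite ltf_pV2 ?posrE ?ltr0n// ltr_nat ltnS.
    by rewrite ltnNge (ltnW ilt).
  rewrite openE => x /hA[e e0 eA]; apply: filterS eA _.
  have [n] := ltr_add_invr e0; rewrite add0r => ne.
  apply: filterS (cylinder_nbhs n.+1 x) => y /cantor_dist_lt dxy /=.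
  exact: lt_trans dxy ne.
Qed.

Lemma cantor_covering_dim_zero : covering_dim_zero cantor_space.
Proof.
split; first by exists (fun=> false).
move=> n U oU cU.
(* A Lebesgue number: by compactness one length [N] serves all points. The refinement then consists
   of the cylinders of length [N]. *)
have : \forall N \near \oo, [set: cantor_space] `<=`
    (fun x => exists k, cylinder N x `<=` U k).
  apply: (compact_near_coveringP _).1 => // [|x _]; first exact: cantor_space_compact.
  have [k Ukx] := cU x.
  have [m mU] := nbhs_cylinder (open_nbhs_nbhs (conj (oU k) Ukx)).
  exists (cylinder m x, [set N | (m <= N)%N]) => /=.
    by split; [exact: cylinder_nbhs|exists m].
  move=> [y N] /= [yx mN]; exists k => z zy; apply: mU => i im.
  by rewrite zy ?yx// (leq_trans im).
case=> N _ /(_ N (leqnn N)) NU.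
pose code (x : cantor_space) := [ffun i : 'I_N => x i].
have codeP x y : code x = code y <-> cylinder N x y.
  split=> [/ffunP e i iN|xy]; first by have := e (Ordinal iN); rewrite !ffunE.
  by apply/ffunP => i; rewrite !ffunE xy.
exists #|{: {ffun 'I_N -> bool}}|, (fun k => [set x | code x = enum_val k]); split.
- move=> k; rewrite openE => x /= xk; apply: filterS (cylinder_nbhs N x) => y.
  by move=> /codeP yx /=; rewrite -yx.
- by move=> x; exists (enum_rank (code x)); rewrite /= enum_rankK.
(* A word that is no point's code gives an empty class, which lies in any member of the cover; the
   one containing the zero sequence is taken. *)
- move=> k; have [[x xk]|nk] := pselect (exists x, code x = enum_val k).
    have [k' xU] := NU x I; exists k' => y /= yk; apply: xU; apply/codeP.
    by rewrite xk yk.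
  have [k' _] := cU (fun=> false); exists k' => y /= yk; exfalso; apply: nk.
  by exists y.
- move=> k k' kk'; apply/seteqP; split=> // x [/= -> /enum_val_inj kk].
  by rewrite kk eqxx in kk'.
Qed.

Local Open Scope ring_scope.

(** * Convergence and separation in the complex plane *)

Lemma cvg_CCP (S : Type) (F : set_system S) (f : S -> CC) (c : CC) :
  Filter F ->
  f @ F --> c <-> forall e : CC, 0 < e -> F [set s | `|f s - c| < e].
Proof.
move=> FF; rewrite cvg_ballP; split=> h e e0.
  by apply: filterS (h e e0) => s; rewrite /ball /= distrC.
by apply: filterS (h e e0) => s; rewrite /ball /= distrC.
Qed.

Lemma CC_hausdorff : hausdorff_space CC.
Proof.
move=> a b ab; apply/eqP; apply: contrapT => /negP; rewrite -subr_eq0 -normr_gt0 => d0.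
have e0 : 0 < `|a - b| / 2 :> CC by rewrite divr_gt0.
have [x [ax bx]] := ab _ _ (nbhsx_ballx a _ e0) (nbhsx_ballx b _ e0).
have := ball_triangle ax (ball_sym bx); by rewrite -splitr /ball /= ltxx.
Qed.

(** * The algebra RUCB(G) *)

Section RUCB_algebra.
Variable G : topGroup.
Implicit Types (f g : G -> CC) (A B : set G).

Lemma rucb_cst (c : CC) : rucb (fun _ : G => c).
Proof.
split; first by exists `|c|.
by move=> e e0; exists setT; split=> [|g x _]; [exact: filterT|rewrite subrr normr0].
Qed.

Lemma rucbD f g : rucb f -> rucb g -> rucb (fun x => f x + g x).
Proof.
move=> [[M fM] fu] [[N gN] gu]; split.
  by exists (M + N) => x; rewrite (le_trans (ler_normD _ _))// lerD.
move=> e e0; have e20 : 0 < e / 2 by rewrite divr_gt0.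
have [V [nV fV]] := fu _ e20; have [W [nW gW]] := gu _ e20.
exists (V `&` W); split=> [|v x [Vv Wv]]; first exact: filterI.
rewrite opprD addrACA (le_lt_trans (ler_normD _ _))// [ltRHS]splitr.
by rewrite ltrD ?fV ?gW.
Qed.

Lemma rucbM f g : rucb f -> rucb g -> rucb (fun x => f x * g x).
Proof.
move=> [[M fM] fu] [[N gN] gu].
have M0 : 0 <= M := le_trans (normr_ge0 _) (fM tg_one).
have N0 : 0 <= N := le_trans (normr_ge0 _) (gN tg_one).
split; first by exists (M * N) => x; rewrite normrM ler_pM.
(* The summand 1 keeps the divisor positive when both bounds vanish and makes the final estimate
   $e(M+N)/(M+N+1) < e$ strict. *)
move=> e e0; have d0 : 0 < M + N + 1 by rewrite ltr_wpDl ?addr_ge0.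
have ed0 : 0 < e / (M + N + 1) by rewrite divr_gt0.
have [V [nV fV]] := fu _ ed0; have [W [nW gW]] := gu _ ed0.
exists (V `&` W); split=> [|v x [Vv Wv]]; first exact: filterI.
have -> : f (tg_mul v x) * g (tg_mul v x) - f x * g x =
    f (tg_mul v x) * (g (tg_mul v x) - g x) + (f (tg_mul v x) - f x) * g x.
  by rewrite mulrBr mulrBl addrA subrK.
rewrite (le_lt_trans (ler_normD _ _))// !normrM.
apply: (@le_lt_trans _ _ (M * (e / (M + N + 1)) + (e / (M + N + 1)) * N)).
  by apply: lerD; apply: ler_pM => //; apply: ltW; [exact: gW|exact: fV].
rewrite [_ * N]mulrC -mulrDl mulrCA -[ltRHS]mulr1 ltr_pM2l//.
by rewrite ltr_pdivrMr// mul1r ltrDl.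
Qed.

(* Subsets of [G] that are clopen for the right uniformity. Their indicator
   functions are the idempotents of RUCB(G). *)
Definition uclopen A := exists V : set G, nbhs tg_one V /\
  forall v x, V v -> (A (tg_mul v x) <-> A x).

(** This is $g^{-1}A$. It is a right action on sets, so precomposing a state with it gives a left
    action. *)
Definition ltrans (g : G) A : set G := [set h | A (tg_mul g h)].

Lemma uclopen0 : uclopen set0.
Proof. by exists setT; split=> //; exact: filterT. Qed.

Lemma uclopenC A : uclopen A -> uclopen (~` A).
Proof.
move=> [V [nV VA]]; exists V; split=> // v x Vv; have vA := VA v x Vv.
by split; apply: contra_not; apply vA.
Qed.

Lemma uclopenI A B : uclopen A -> uclopen B -> uclopen (A `&` B).
Proof.
move=> [V [nV VA]] [W [nW WB]]; exists (V `&` W); split; first exact: filterI.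
move=> v x [Vv Wv]; have vA := VA v x Vv; have vB := WB v x Wv.
by split=> -[? ?]; split; apply/vA || apply/vB.
Qed.

(** Since $gvx = (gvg^{-1})gx$, invariance of [A] under [V] becomes invariance of the translate
    under $g^{-1}Vg$. *)
Lemma uclopen_ltrans (g : G) A : uclopen A -> uclopen (ltrans g A).
Proof.
move=> [V [nV VA]].
exists ((fun v : G => tg_mul (tg_mul g v) (tg_inv g)) @^-1` V); split.
  apply: (@tg_conj_cont G g tg_one).
  by rewrite tg_mulg1 tg_mulgV.
move=> v x /= Vv; have := VA _ (tg_mul g x) Vv.
by rewrite -!tg_mulA [tg_mul (tg_inv g) _]tg_mulA tg_mulVg tg_mul1g.
Qed.

Definition indf A (x : G) : CC := (x \in A)%:R.

Lemma rucb_indf A : uclopen A -> rucb (indf A).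
Proof.
move=> [V [nV VA]]; split.
  by exists 1 => x; rewrite /indf; case: (x \in A); rewrite ?normr1 ?normr0.
move=> e e0; exists V; split=> // v x Vv; have vA := VA v x Vv.
by rewrite /indf (_ : (_ \in _) = (x \in A)) ?subrr ?normr0//; apply/idP/idP; rewrite !inE => /vA.
Qed.

(** Cutting off by the indicator keeps the inverse bounded; on [A], uniform continuity follows from
    $a^{-1}-b^{-1} = -(a-b)/(ab)$ and $|ab| \ge d^2$. *)
Lemma rucb_inv f A (d : CC) : rucb f -> uclopen A -> 0 < d ->
  (forall x, A x -> d <= `|f x|) -> rucb (fun x => indf A x * (f x)^-1).
Proof.
move=> [_ fu] [V [nV VA]] d0 df; split.
  exists d^-1 => x; rewrite /indf; have [/set_mem Ax|_] := boolP (x \in A).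
    by rewrite mul1r normfV lef_pV2 ?posrE// ?df// (lt_le_trans d0)// df.
  by rewrite mul0r normr0 invr_ge0 ltW.
move=> e e0; have ed0 : 0 < e * (d * d) by rewrite !mulr_gt0.
have [W [nW fW]] := fu _ ed0.
exists (V `&` W); split=> [|v x [Vv Wv]]; first exact: filterI.
have vA := VA v x Vv.
rewrite /indf (_ : (_ \in _) = (x \in A)); last first.
  by apply/idP/idP; rewrite !inE => /vA.
have [/set_mem Ax|_] := boolP (x \in A); last by rewrite !mul0r subrr normr0.
have := df _ Ax; have := df _ (vA.2 Ax); have := fW v x Wv.
set a := f (tg_mul v x); set b := f x => ab da db.
have a0 : a != 0 by rewrite -normr_gt0 (lt_le_trans d0).
have b0 : b != 0 by rewrite -normr_gt0 (lt_le_trans d0).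
have -> : 1%:R * a^-1 - 1%:R * b^-1 = - (a - b) * (a * b)^-1.
  by rewrite !mul1r opprB mulrBl invfM mulrCA mulfV// mulr1 mulrA mulfV// mul1r.
rewrite normrM normrN normfV normrM ltr_pdivrMr ?mulr_gt0 ?normr_gt0//.
by apply: lt_le_trans ab _; rewrite ler_pM2l// ler_pM// ltW.
Qed.

End RUCB_algebra.

(** * Ultrafilters of uniformly clopen sets *)

Section Ultra.
Variable G : topGroup.
Implicit Types (A B : set G) (phi : ambit_space G).

Definition state : topologicalType := {ptws set G -> bool}.

(* Ultrafilters on the Boolean algebra of uniformly clopen sets; the value
   [false] outside the algebra makes the encoding by a state unique. *)
Definition ultra (z : state) : Prop :=
  [/\ z set0 = false,
      (forall A, uclopen A -> z (~` A) = ~~ z A),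
      (forall A B, uclopen A -> uclopen B -> z (A `&` B) = z A && z B) &
      (forall A, ~ uclopen A -> z A = false)].

Definition state_filter (z : state) : set_system G :=
  [set U | exists A, [/\ uclopen A, z A & A `<=` U]].

Lemma state_filter_proper z : ultra z -> ProperFilter (state_filter z).
Proof.
move=> [z0 zC zI _]; split.
  by move=> [A [_ zA]]; rewrite subset0 => A0; rewrite A0 z0 in zA.
split.
- exists setT; split=> //; rewrite -setC0; first exact/uclopenC/uclopen0.
  by rewrite zC ?z0//; exact: uclopen0.
- move=> U W [A [uA zA AU]] [B [uB zB BW]]; exists (A `&` B); split.
  + exact: uclopenI.
  + by rewrite zI// zA.
  + by move=> x [/AU ? /BW].
- by move=> U W UW [A [uA zA AU]]; exists A; split=> // x /AU/UW.
Qed.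

(** This is $V^{-1}D$, which equals $VD$ when [V] is a subgroup. Enlarging level sets in this way is
    how the open subgroups of a non-archimedean group yield uniformly clopen sets. *)
Definition saturation (V D : set G) : set G :=
  [set x | exists2 v, V v & D (tg_mul v x)].

Lemma uclopen_saturation V D : open_subgroup V -> uclopen (saturation V D).
Proof.
move=> [oV V1 VM VV]; exists V; split; first exact: open_nbhs_nbhs.
move=> v x Vv; split=> -[w Vw Dw].
  by exists (tg_mul w v); [exact: VM|rewrite -tg_mulA].
exists (tg_mul w (tg_inv v)); first by apply: VM => //; exact: VV.
by rewrite -tg_mulA [tg_mul (tg_inv v) _]tg_mulA tg_mulVg tg_mul1g.
Qed.

Lemma sub_saturation V D : open_subgroup V -> D `<=` saturation V D.
Proof. by move=> [_ V1 _ _] x Dx; exists tg_one; rewrite ?tg_mul1g. Qed.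

Hypothesis naG : non_archimedean G.

(** The limit is the supremum of all [t] with $r \ge t$ on a set of the filter. For the upper
    estimate, the level set $r \ge \sup S + e$ is saturated by an open subgroup along which [r]
    varies by less than $e/2$. If the saturation [A] belonged to [z], then $\sup S + e/2$ would lie
    in [S]; hence the complement of [A] belongs to [z]. *)
Lemma real_limit z (r : G -> RR) (M : RR) : ultra z ->
  (forall x, `|r x| <= M) ->
  (forall e : RR, 0 < e -> exists V, nbhs tg_one V /\
     forall v x, V v -> `|r (tg_mul v x) - r x| < e) ->
  exists L : RR, forall e : RR, 0 < e -> state_filter z [set x | `|r x - L| < e].
Proof.
move=> uz rM ru; have PF := state_filter_proper uz.
pose S : set RR := [set t | state_filter z [set x | t <= r x]].
have SM t : S t -> t <= M.
  by move=> /filter_ex[x /= tx]; apply: le_trans tx (le_trans (ler_norm _) (rM x)).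
have hS : has_sup S.
  split; last by exists M => t; exact: SM.
  exists (- M); apply: filterS filterT => x _ /=.
  by rewrite lerNl (le_trans (ler_norm _))// normrN.
exists (sup S) => e e0.
have lo : state_filter z [set x | sup S - e < r x].
  have [t St et] := sup_adherent e0 hS.
  by apply: filterS St => x /= tx; exact: lt_le_trans et tx.
suff hi : state_filter z [set x | r x < sup S + e].
  apply: filterS (filterI lo hi) => x /= [xl xh].
  by rewrite ltr_norml ltrBlDl xh ltrBrDl xl.
have e20 : 0 < e / 2 by rewrite divr_gt0.
have [W [nW rW]] := ru _ e20; have [V [sV VW]] := naG.2 W nW.
pose A := saturation V [set x | sup S + e <= r x].
have uA : uclopen A by exact: uclopen_saturation.
have [_ zC _ _] := uz.
have [zA|zA] := boolP (z A).
  suff : S (sup S + e / 2).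
    by move/(ub_le_sup hS.2); rewrite -subr_ge0 opprD addrA subrr add0r oppr_ge0 leNgt e20.
  exists A; split=> // x [v Vv /= vx].
  have := rW v x (VW _ Vv); rewrite ltr_norml => /andP[_].
  rewrite ltrBlDl -ltrBlDr => /ltW; apply: le_trans.
  by rewrite lerBrDr -addrA -splitr.
exists (~` A); split; [exact: uclopenC|by rewrite zC|].
move=> x nAx /=; rewrite ltNge; apply/negP => hx; apply: nAx.
exact: sub_saturation.
Qed.

Lemma normc_le_ReIm (w : CC) : `|w| <= (`|complex.Re w| + `|complex.Im w|)%:C%C.
Proof.
rewrite [X in `|X|]complexE (le_trans (ler_normD _ _))// normrM.
have -> : `|'i%C : CC| = 1 by rewrite normc_def /= expr0n add0r expr1n sqrtr1.
rewrite mul1r rmorphD /= lerD//.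
  by rewrite normc_def /= expr0n addr0 sqrtr_sqr.
by rewrite normc_def /= expr0n addr0 sqrtr_sqr.
Qed.

Lemma normc_ge_Im (w : CC) : `|complex.Im w|%:C%C <= `|w|.
Proof.
rewrite normc_def lecR -sqrtr_sqr ler_sqrt ?lerDr ?sqr_ge0//.
by rewrite addr_ge0 ?sqr_ge0.
Qed.

Lemma CC_gt0 (e : CC) : 0 < e -> exists2 r : RR, 0 < r & e = r%:C%C.
Proof.
by case: e => a b; rewrite ltcE /= => /andP[/eqP -> a0]; exists a.
Qed.

Lemma rucb_limit z (f : G -> CC) : ultra z -> rucb f ->
  exists c : CC, f @ state_filter z --> c.
Proof.
move=> uz [[M fM] fu]; have PF := state_filter_proper uz.
(* [p] stands for the real or the imaginary part: both respect differences and do not increase the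
   modulus. *)
have H (p : CC -> RR) : (forall w, `|p w|%:C%C <= `|w|) ->
    (forall a b, p (a - b) = p a - p b) ->
    exists L : RR, forall e : RR, 0 < e -> state_filter z [set x | `|p (f x) - L| < e].
  move=> pn pB; apply: (@real_limit z (p \o f) (complex.Re M)) => //.
    move=> x /=; have := le_trans (pn (f x)) (fM x).
    by rewrite lecE => /andP[].
  move=> e e0; have [|V [nV fV]] := fu e%:C%C; first by rewrite ltcR.
  exists V; split=> // v x Vv /=; rewrite -pB -ltcR.
  exact: le_lt_trans (pn _) (fV _ _ Vv).
have [] := H (@complex.Re RR) (@normc_ge_Re RR); first by case=> a b [c d].
move=> L1 HL1.
have [] := H (@complex.Im RR) normc_ge_Im; first by case=> a b [c d].
move=> L2 HL2; exists (L1 +i* L2)%C; apply/cvg_CCP => _ /CC_gt0[e e0 ->].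
have e20 : 0 < e / 2 by rewrite divr_gt0.
apply: filterS (filterI (HL1 _ e20) (HL2 _ e20)) => x [h1 h2].
apply: le_lt_trans (normc_le_ReIm _) _.
have -> : complex.Re (f x - (L1 +i* L2)%C) = complex.Re (f x) - L1 by case: (f x).
have -> : complex.Im (f x - (L1 +i* L2)%C) = complex.Im (f x) - L2 by case: (f x).
by rewrite ltcR [ltRHS]splitr ltrD.
Qed.

(** The limit of [f] along the ultrafilter. The default 0 is taken only when no limit exists, which
    [rucb_limit] excludes for ultrafilters. *)
Definition state_char (z : state) : ambit_space G :=
  fun f => xget 0 [set c : CC | sval f @ state_filter z --> c].

Lemma state_char_cvg z f : ultra z ->
  sval f @ state_filter z --> (state_char z f : CC).
Proof.
move=> uz; have [c fc] := rucb_limit uz (svalP f).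
by rewrite /state_char; case: xgetP => [_ -> //|/(_ c)].
Qed.

Lemma state_char_eq z f (c : CC) : ultra z ->
  sval f @ state_filter z --> c -> state_char z f = c.
Proof.
move=> uz fc; have PF := state_filter_proper uz.
exact: (cvg_unique CC_hausdorff (@state_char_cvg z f uz) fc).
Qed.

End Ultra.

(** * Characters of RUCB(G) *)

Section Characters.
Variable G : topGroup.
Hypothesis naG : non_archimedean G.
Implicit Types (A B : set G) (phi : ambit_space G).

Lemma state_char_character (z : state G) :
  ultra z -> is_character (state_char z).
Proof.
move=> uz; have PF := state_filter_proper uz.
have cv f := @state_char_cvg G naG z f uz.
split=> [f g h hE|c f h hE|f g h hE|].
- by apply: state_char_eq => //; rewrite hE; exact: (cvgD (cv f) (cv g)).
- apply: state_char_eq => //; rewrite hE.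
  by apply: cvgM (cv f); exact: cvg_cst.
- by apply: state_char_eq => //; rewrite hE; exact: (cvgM (cv f) (cv g)).
- exists (exist _ (fun=> 1) (rucb_cst G 1)).
  by rewrite (@state_char_eq _ naG _ _ 1)// ?oner_eq0//; exact: cvg_cst.
Qed.

(** Extending a character by 0 to all functions lets one compute with plain functions, without
    carrying proofs of membership in RUCB(G). *)
Definition char_on phi (f : G -> CC) : CC :=
  if pselect (rucb f) is left p then phi (exist _ f p) else 0.

Lemma char_onE phi (f : RUCB G) : char_on phi (sval f) = phi f.
Proof.
case: f => f rf; rewrite /char_on /=; case: pselect => // p.
by rewrite (Prop_irrelevance p rf).
Qed.

Lemma char_on_act g phi f : rucb f ->
  char_on (ambit_act g phi) f = char_on phi (fun x => f (tg_mul g x)).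
Proof.
move=> rf; rewrite -[f]/(sval (exist _ f rf)) char_onE /ambit_act -char_onE.
by [].
Qed.

Section Character.
Variable phi : ambit_space G.
Hypothesis cphi : is_character phi.
Local Notation chi := (char_on phi).

Lemma char_onD f g : rucb f -> rucb g ->
  chi (fun x => f x + g x) = chi f + chi g.
Proof.
move=> rf rg; have [pD _ _ _] := cphi.
rewrite -[f in RHS]/(sval (exist _ f rf)) -[g in RHS]/(sval (exist _ g rg)).
rewrite -[LHS]/(chi (sval (exist _ _ (rucbD rf rg)))) !char_onE.
exact: pD.
Qed.

Lemma char_onM f g : rucb f -> rucb g ->
  chi (fun x => f x * g x) = chi f * chi g.
Proof.
move=> rf rg; have [_ _ pM _] := cphi.
rewrite -[f in RHS]/(sval (exist _ f rf)) -[g in RHS]/(sval (exist _ g rg)).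
rewrite -[LHS]/(chi (sval (exist _ _ (rucbM rf rg)))) !char_onE.
exact: pM.
Qed.

Lemma char_on_cst (c : CC) : chi (fun=> c) = c.
Proof.
have [_ pZ pM [f f0]] := cphi.
(* The nonzero value [phi f] cancels from $\phi(1)\phi(f) = \phi(f)$; homogeneity then gives all
   constants. *)
have chi1 : chi (fun=> 1) = 1.
  apply: (mulIf f0); rewrite mul1r -char_onE -char_onM; last exact: svalP.
    by congr chi; apply: funext => x; rewrite mul1r.
  exact: rucb_cst.
rewrite -[LHS]/(chi (sval (exist _ _ (rucb_cst G c)))) char_onE.
rewrite (pZ c (exist _ _ (rucb_cst G 1))) -?char_onE ?chi1 ?mulr1//.
by apply: funext => x; rewrite /= mulr1.
Qed.

Lemma char_on_indf_idem A : uclopen A -> chi (indf A) = 0 \/ chi (indf A) = 1.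
Proof.
move=> uA; have r := rucb_indf uA.
have := char_onM r r.
have -> : (fun x => indf A x * indf A x) = indf A.
  by apply: funext => x; rewrite /indf; case: (x \in A); rewrite ?mulr1 ?mulr0.
move/eqP; rewrite -subr_eq0 -[X in X - _]mulr1 -mulrBr mulf_eq0 subr_eq0.
by case/orP => /eqP; [left|right].
Qed.

Lemma char_on_indfC A : uclopen A -> chi (indf (~` A)) = 1 - chi (indf A).
Proof.
move=> uA; have rA := rucb_indf uA; have rC := rucb_indf (uclopenC uA).
apply/eqP; rewrite eq_sym subr_eq -char_onD//; apply/eqP; rewrite -[LHS]char_on_cst.
congr chi; apply: funext => x; rewrite /indf in_setC.
by case: (x \in A); rewrite ?addr0 ?add0r.
Qed.

Lemma char_on_indfI A B : uclopen A -> uclopen B ->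
  chi (indf (A `&` B)) = chi (indf A) * chi (indf B).
Proof.
move=> uA uB; rewrite -char_onM; [|exact: rucb_indf..].
congr chi; apply: funext => x; rewrite /indf in_setI.
by case: (x \in A); case: (x \in B); rewrite ?mulr0 ?mulr1.
Qed.

End Character.

Definition char_state phi : state G :=
  fun A => `[< uclopen A /\ char_on phi (indf A) = 1 >].

Lemma char_stateE phi A : uclopen A ->
  char_state phi A = (char_on phi (indf A) == 1).
Proof. by move=> uA; apply/asboolP/eqP => [[]|]. Qed.

Lemma char_state_ultra phi : is_character phi -> ultra (char_state phi).
Proof.
move=> cphi; split=> [|A uA|A B uA uB|A nA].
- rewrite char_stateE; last exact: uclopen0.
  have -> : indf set0 = fun _ : G => 0 by apply: funext => x; rewrite /indf in_set0.
  by rewrite char_on_cst// eq_sym oner_eq0.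
- rewrite !char_stateE//; last exact: uclopenC.
  rewrite char_on_indfC//; have [->|->] := char_on_indf_idem cphi uA.
    by rewrite subr0 eqxx eq_sym oner_eq0.
  by rewrite subrr eqxx eq_sym oner_eq0.
- rewrite !char_stateE//; last exact: uclopenI.
  rewrite char_on_indfI//.
  have [->|->] := char_on_indf_idem cphi uA; last by rewrite mul1r eqxx.
  by rewrite mul0r eq_sym oner_eq0.
- by apply/asboolP => -[].
Qed.

Lemma state_charK (z : state G) : ultra z -> char_state (state_char z) = z.
Proof.
move=> uz; have PF := state_filter_proper uz; have [_ zC _ zN] := uz.
apply: functional_extensionality_dep => A.
have [uA|nA] := pselect (uclopen A); last first.
  by rewrite zN//; apply/asboolP => -[].
have rA := rucb_indf uA.
rewrite char_stateE// -[indf A]/(sval (exist _ _ rA)) char_onE.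
(* If the indicator is constant on a set of the ultrafilter, that constant is its limit. This is
   applied to [A] with value 1 and to its complement with value 0. *)
have H (B : set G) (c : CC) : uclopen B -> z B -> (forall x, B x -> indf A x = c) ->
    state_char z (exist _ _ rA) = c.
  move=> uB zB Bc; apply: state_char_eq => //; apply/cvg_CCP => e e0.
  by exists B; split=> // x /Bc /= ->; rewrite subrr normr0.
have [zA|zA] := boolP (z A).
  rewrite (H A 1)// ?eqxx// => x Ax.
  by rewrite /indf mem_set.
rewrite (H (~` A) 0) 1?eq_sym ?oner_eq0 ?zC//; first exact: uclopenC.
by move=> x Ax; rewrite /indf memNset.
Qed.

(* If [f] stayed away from [phi f] on a set [~` A] of full [phi]-mass, then
   [f - phi f] would be invertible there although [phi] kills it. *)
Lemma char_stateK phi : is_character phi -> state_char (char_state phi) = phi.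
Proof.
move=> cphi; have uz := char_state_ultra cphi; have PF := state_filter_proper uz.
apply: functional_extensionality_dep => f.
apply: (@state_char_eq G naG) => //; apply/cvg_CCP => e e0.
have [fb fu] := svalP f; have e20 : 0 < e / 2 by rewrite divr_gt0.
have [W [nW fW]] := fu _ e20; have [V [sV VW]] := naG.2 W nW.
(* Half of [e] bounds the distance at a point of the level set, the other half the variation of [f]
   along [V]. *)
pose A := saturation V [set x | `|sval f x - phi f| < e / 2].
have uA : uclopen A by exact: uclopen_saturation.
have AE : A `<=` [set x | `|sval f x - phi f| < e].
  move=> x [v Vv /= vx]; rewrite -(subrK (sval f (tg_mul v x)) (sval f x)) -addrA.
  rewrite (le_lt_trans (ler_normD _ _))// [ltRHS]splitr ltrD// distrC fW//.
  exact: VW.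
exists A; split=> //; apply: contrapT => /negP zA.
have [_ zC _ _] := uz; rewrite -zC// char_stateE in zA; last exact: uclopenC.
have far x : (~` A) x -> e / 2 <= `|sval f x - phi f|.
  move=> nAx; rewrite real_leNgt ?ger0_real ?(ltW e20)//; apply/negP => xe.
  by apply: nAx; exact: sub_saturation.
have rg : rucb (fun x => sval f x + - phi f).
  by apply: rucbD; [exact: svalP|exact: rucb_cst].
have rh : rucb (fun x => indf (~` A) x * (sval f x - phi f)^-1).
  exact: (rucb_inv rg (uclopenC uA) e20).
have : char_on phi (indf (~` A)) = 0.
  have -> : indf (~` A) = fun x => (indf (~` A) x * (sval f x - phi f)^-1) *
                            (sval f x + - phi f).
    apply: funext => x; rewrite -mulrA.
    have [|nAx] := boolP (x \in ~` A); last by rewrite /indf (negbTE nAx) mul0r.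
    by move=> /set_mem nAx; rewrite mulVf ?mulr1// -normr_gt0 (lt_le_trans e20)// far.
  have rc := rucb_cst G (- phi f); rewrite char_onM// (char_onD cphi (svalP f) rc).
  by rewrite char_on_cst// char_onE subrr mulr0.
by rewrite (eqP zA) => /eqP; rewrite oner_eq0.
Qed.

Definition state_act (g : G) (z : state G) : state G := fun A => z (ltrans g A).

Lemma uclopen_ltransE (g : G) A : uclopen (ltrans g A) <-> uclopen A.
Proof.
split=> [/(uclopen_ltrans (tg_inv g))|]; last exact: uclopen_ltrans.
congr uclopen; apply: funext => x.
by rewrite /ltrans /= tg_mulA tg_mulgV tg_mul1g.
Qed.

Lemma ltransC (g : G) A : ltrans g (~` A) = ~` ltrans g A.
Proof. by []. Qed.

Lemma state_act_ultra (g : G) (z : state G) : ultra z -> ultra (state_act g z).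
Proof.
move=> [z0 zC zI zN]; split=> [|A uA|A B uA uB|A nA]; rewrite /state_act.
- exact: z0.
- by rewrite ltransC zC//; exact: uclopen_ltrans.
- by rewrite -zI//; exact: uclopen_ltrans.
- by rewrite zN// uclopen_ltransE.
Qed.

Lemma char_state_act (g : G) phi :
  char_state (ambit_act g phi) = state_act g (char_state phi).
Proof.
apply: functional_extensionality_dep => A; rewrite /state_act.
have [uA|nA] := pselect (uclopen A); last first.
  rewrite /char_state; apply/asboolP/asboolP => -[//].
  by rewrite uclopen_ltransE.
rewrite !char_stateE//; last exact: uclopen_ltrans.
rewrite char_on_act; last exact: rucb_indf.
suff -> : (fun x => indf A (tg_mul g x)) = indf (ltrans g A) by [].
by apply: funext => x; congr (_%:R); apply/idP/idP; rewrite !inE.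
Qed.

End Characters.

Lemma bool_cvg (S : Type) (F : set_system S) (f : S -> bool) (b : bool) :
  Filter F -> F [set s | f s = b] -> f @ F --> b.
Proof.
move=> FF Fb U /nbhs_singleton Ub; suff : F (f @^-1` U) by [].
by apply: filterS Fb => s /= ->.
Qed.

Lemma countable_setU (T : Type) (A B : set T) :
  countable A -> countable B -> countable (A `|` B).
Proof.
move=> cA cB.
rewrite (_ : A `|` B = \bigcup_(b in [set: bool]) (if b then A else B)).
  by apply: bigcup_countable => // -[].
apply/seteqP; split=> [x [Ax|Bx]|x [[] _]]; by [exists true|exists false|left|right].
Qed.

(** * Restriction of ultrafilters to countable families *)

Section Families.
Variable G : topGroup.
Hypothesis sepG : separable_space G.
Implicit Types (F : set (set G)) (A B : set G) (z : state G).

Lemma nbhs_state_coord z A : nbhs z [set w : state G | w A = z A].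
Proof.
have h : (fun w : state G => w A) @ z --> z A := @prod_coord_continuous _ (fun=> bool) A z.
exact: h (discrete_set1 (z A)).
Qed.

Lemma state_compact : compact [set: state G].
Proof.
have := @tychonoff {classic set G} (fun=> bool) _ (fun=> bool_compact).
by congr (compact _); rewrite eqEsubset.
Qed.

Lemma state_hausdorff : hausdorff_space (state G).
Proof.
by apply: (@hausdorff_product {classic set G} (fun=> bool)) => ?; exact: discrete_hausdorff.
Qed.

(** Each axiom involves at most three coordinates, and every coordinate is locally constant on
    [state G]. *)
Lemma ultra_closed : closed [set z : state G | ultra z].
Proof.
move=> z cz; have N := nbhs_state_coord z; split=> [|A uA|A B uA uB|A nA].
- by have [w [[w0 _ _ _] /= <-]] := cz _ (N set0).
- have [w [[_ wC _ _] [/= <- <-]]] := cz _ (filterI (N A) (N (~` A))).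
  exact: wC.
- have [w [[_ _ wI _] [/= <- [<- <-]]]] := cz _ (filterI (N (A `&` B)) (filterI (N A) (N B))).
  exact: wI.
- by have [w [[_ _ _ wN] /= <-]] := cz _ (N A); exact: wN.
Qed.

(** The value [false] off [F] keeps all restrictions in the one space [state G], where those to
    different families compare by plain equality. *)
Definition restr F z : state G := fun A => `[< F A >] && z A.

Lemma restr_cvg (S : Type) (L : set_system S) F (f : S -> state G) z : Filter L ->
  (forall A, F A -> L [set s | f s A = z A]) ->
  (fun s => restr F (f s)) @ L --> restr F z.
Proof.
move=> FL h; apply: prod_coord_cvg => A; apply: bool_cvg; rewrite /restr.
have [FA|nFA] := pselect (F A).
  by apply: filterS (h _ FA) => s /= ->.
apply: filterS filterT => s _ /=.
by rewrite asboolF.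
Qed.

Lemma restr_continuous F : continuous (restr F).
Proof. by move=> z; apply: restr_cvg => A _; exact: nbhs_state_coord. Qed.

Lemma restrE F z A : F A -> restr F z A = z A.
Proof. by move=> FA; rewrite /restr asboolT. Qed.

Lemma restrN F z A : ~ F A -> restr F z A = false.
Proof. by move=> FA; rewrite /restr asboolF. Qed.

Lemma restr_restr F F' z : F `<=` F' -> restr F (restr F' z) = restr F z.
Proof.
move=> FF'; apply: functional_extensionality_dep => A.
by have [FA|nFA] := pselect (F A); [rewrite !restrE//; exact: FF'|rewrite !restrN].
Qed.

Definition restr_ultra F : set (state G) := restr F @` [set z | ultra z].

Lemma restr_ultra_compact F : compact (restr_ultra F).
Proof.
apply: continuous_compact.
  by apply: continuous_subspaceT; exact: restr_continuous.
by apply: subclosed_compact state_compact _ => //; exact: ultra_closed.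
Qed.

(** The principal ultrafilter at the identity shows that the spaces of restricted ultrafilters are
    nonempty, as Brouwer's theorem requires. *)
Lemma ultra_principal : ultra (fun A => `[< uclopen A /\ A tg_one >] : bool).
Proof.
split=> [|A uA|A B uA uB|A nA].
- by apply/asboolP => -[].
- rewrite -asbool_neg; apply: asbool_equiv_eq; split=> [[_ nA] [_ /nA//]|nA].
  by split; [exact: uclopenC|move=> A1; apply: nA].
- rewrite -asbool_and; apply: asbool_equiv_eq.
  by split=> [[_ [? ?]]//|[[_ ?] [_ ?]]]; split=> //; exact: uclopenI.
- by apply/asboolP => -[].
Qed.

Definition admissible F : Prop :=
  [/\ countable F, F `<=` @uclopen G & forall g A, F A -> F (ltrans g A)].

Lemma admissible_ltrans F (g : G) A : admissible F -> F (ltrans g A) <-> F A.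
Proof.
move=> [_ _ FG]; split=> [/(FG (tg_inv g))|]; last exact: FG.
congr F; apply: funext => x; apply/propext.
by rewrite /ltrans /= tg_mulA tg_mulgV tg_mul1g.
Qed.

Lemma restr_act F (g : G) z : admissible F ->
  restr F (state_act g z) = state_act g (restr F z).
Proof.
move=> aF; apply: functional_extensionality_dep => A.
by rewrite /restr /state_act (asbool_equiv_eq (admissible_ltrans g A aF)).
Qed.

Lemma admissible0 : admissible set0.
Proof. by split=> //; exact: countable0. Qed.

Lemma admissibleU F F' : admissible F -> admissible F' -> admissible (F `|` F').
Proof.
move=> [cF uF gF] [cF' uF' gF']; split.
- exact: countable_setU.
- by move=> A [/uF|/uF'].
- by move=> g A [/gF|/gF']; [left|right].
Qed.

(** Write $hx = (hg^{-1})(gx)$ with $hg^{-1}$ in [V]. This local constancy yields both the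
    countability of orbits and the continuity of the actions. *)
Lemma near_ltrans_eq (g : G) A : uclopen A ->
  nbhs g [set h | ltrans h A = ltrans g A].
Proof.
move=> [V [nV VA]]; pose m (h : G) := tg_mul h (tg_inv g).
have cm : continuous m.
  move=> w; apply: (continuous_comp (f := fun w : G => (w, tg_inv g))
                      (g := fun p : G * G => tg_mul p.1 p.2)); last exact: tg_mul_cont.
  by apply: cvg_to_pair; [exact: cvg_id | exact: cvg_cst].
have ng : nbhs g (m @^-1` V) by apply: cm; rewrite /m tg_mulgV.
apply: filterS ng => h Vh; apply: funext => x; apply/propext; rewrite /ltrans /=.
have := VA _ (tg_mul g x) Vh.
by rewrite /m -!tg_mulA [tg_mul (tg_inv g) _]tg_mulA tg_mulVg tg_mul1g.
Qed.

Definition ltrans_orbit A : set (set G) := [set ltrans g A | g in [set: G]].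

(* The stabilizer of [A] is open and [G] is separable. *)
Lemma ltrans_orbit_countable A : uclopen A -> countable (ltrans_orbit A).
Proof.
move=> uA; have [D [cD dD]] := sepG.
apply: (@sub_countable _ _ _ ((fun g => ltrans g A) @` D)); last first.
  exact: sub_countable (card_image_le _ _) cD.
apply: subset_card_le => _ [g _ <-].
have : closure D g by rewrite dD.
by move=> /(_ _ (near_ltrans_eq g uA))[d [Dd /= dg]]; exists d.
Qed.

Lemma admissible_orbit A : uclopen A -> admissible (ltrans_orbit A).
Proof.
move=> uA; split.
- exact: ltrans_orbit_countable.
- by move=> _ [g _ <-]; exact: uclopen_ltrans.
- move=> g _ [h _ <-]; exists (tg_mul h g) => //.
  by apply: funext => x; rewrite /ltrans /= tg_mulA.
Qed.

Lemma orbit_refl A : ltrans_orbit A A.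
Proof. by exists tg_one => //; apply: funext => x; rewrite /ltrans /= tg_mul1g. Qed.

(** An injection [p] of the countable family into the integers codes restricted ultrafilters as
    binary sequences. They thus correspond to a compact subset [L] of the Cantor space, to which
    [cantor_prod_param] applies; [psi] decodes. *)
Lemma restr_ultra_param F : admissible F ->
  exists J : cantor_space -> state G * cantor_space,
    [/\ continuous J, injective J &
        range J = restr_ultra F `*` [set: cantor_space]].
Proof.
move=> [/countable_injP[p pinj] _ _].
pose psi (y : cantor_space) : state G := fun A => `[< F A >] && y (p A).
have psi_cont : continuous psi.
  move=> y; apply: prod_coord_cvg => A; apply: bool_cvg.
  by apply: filterS (cylinder_nbhs (p A).+1 y) => x /(_ _ (ltnSn _)) xy; rewrite /psi /= xy.
(* Requiring zeros outside the image of [F] under [p] makes [psi] injective on [L]. *)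
pose L := [set y | restr_ultra F (psi y) /\
                   forall n, ~ (exists2 A, F A & p A = n) -> y n = false].
have Lsurj x : restr_ultra F x -> exists2 y, L y & psi y = x.
  move=> Kx; pose y : cantor_space := fun n => `[< exists A, [/\ F A, p A = n & x A] >].
  have yx : psi y = x.
    apply: functional_extensionality_dep => A; have [z uz zx] := Kx.
    rewrite /psi; have [FA|nFA] := pselect (F A); last first.
      by rewrite asboolF// -zx restrN.
    rewrite asboolT//=; apply/asboolP/idP => [[B [FB pBA xB]]|xA]; last by exists A.
    by rewrite -(pinj B A) ?inE.
  exists y => //; split; first by rewrite yx.
  by move=> n nn; apply/asboolP => -[A [FA pA _]]; apply: nn; exists A.
have Linj y y' : L y -> L y' -> psi y = psi y' -> y = y'.
  move=> [_ yN] [_ yN'] e; apply: functional_extensionality_dep => n.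
  have [[A FA <-]|nn] := pselect (exists2 A, F A & p A = n); last by rewrite yN ?yN'.
  by have := congr1 (@^~ A) e; rewrite /psi asboolT.
have [l Ll _] : exists2 y, L y & psi y = restr F (fun A => `[< uclopen A /\ A tg_one >]).
  by apply: Lsurj; eexists; last reflexivity; exact: ultra_principal.
have Lcompact : compact L.
  apply: (subclosed_compact _ cantor_space_compact) => //.
  apply: closedI.
    apply: preimage_closed => //.
    by apply: compact_closed; [exact: state_hausdorff|exact: restr_ultra_compact].
  move=> y cy n nn.
  have [x [/(_ n nn) xn /(_ n (ltnSn n)) xy]] := cy _ (cylinder_nbhs n.+1 y).
  by rewrite -xy.
have [J [cJ iJ rJ]] := @cantor_prod_param (prod_topology (fun _ : nat => bool))
  L l Ll Lcompact cantor_space_hausdorff cantor_zero_dimensional.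
have LJ c : L (J c).1.
  by have : range J (J c) by []; rewrite rJ => -[].
exists (fun c => (psi (J c).1, (J c).2)); split.
- move=> c.
  have h1 : (fun c => (J c).1) @ c --> (J c).1.
    by apply: cvg_comp (cJ c) _; exact: cvg_fst.
  have h2 : (fun c => (J c).2) @ c --> (J c).2.
    by apply: cvg_comp (cJ c) _; exact: cvg_snd.
  by apply: cvg_to_pair => //; exact: (cvg_comp _ _ h1 (psi_cont _)).
- move=> c d [/Linj e1 e2]; apply: iJ.
  by rewrite [LHS]surjective_pairing e1// e2 -surjective_pairing.
- rewrite eqEsubset; split=> [_ [c _ <-]|[x c] [/= /Lsurj[y Ly <-] _]].
    by split=> //; have [] := LJ c.
  have : (L `*` [set: cantor_space]) (y, c) by [].
  by rewrite -rJ => -[d _ dE]; exists d => //; rewrite dE.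
Qed.

End Families.

(** * The inverse system *)

Section InverseSystem.
Variable G : topGroup.

Definition index : Type := ({F : set (set G) | admissible F} * nat)%type.
Implicit Types (i j k : index) (y : cantor_space).

Definition family i : set (set G) := sval i.1.

Lemma family_admissible i : admissible (family i).
Proof. exact: svalP. Qed.

(* The level [i.2] makes the strict part of the order free of maximal elements,
   so that the extra Cantor factor can be collapsed along every strict bond. *)
Definition index_le i j : Prop :=
  i = j \/ ((i.2 < j.2)%N /\ family i `<=` family j).

(* The [i]-th space is the Cantor space itself, identified through [coords i]
   with the product of the space of ultrafilters restricted to [family i] and a
   second Cantor space on which [G] acts trivially. *)
Definition coords i : cantor_space -> state G * cantor_space :=
  projT1 (cid (restr_ultra_param (family_admissible i))).

Lemma coords_continuous i : continuous (coords i).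
Proof. by rewrite /coords; case: cid => J []. Qed.

Lemma coords_inj i : injective (coords i).
Proof. by rewrite /coords; case: cid => J []. Qed.

Lemma range_coords i :
  range (coords i) = restr_ultra (family i) `*` [set: cantor_space].
Proof. by rewrite /coords; case: cid => J []. Qed.

(** An inverse of [coords i] on its range; the default value elsewhere is irrelevant to the bonds
    between comparable indices. *)
Definition uncoords i (w : state G * cantor_space) : cantor_space :=
  xget (fun=> false) [set c | coords i c = w].

Lemma uncoordsK i w : restr_ultra (family i) w.1 -> coords i (uncoords i w) = w.
Proof.
move=> Kw; have : range (coords i) w by rewrite range_coords.
by move=> [c _ cw]; rewrite /uncoords; case: xgetP => [d _ //|/(_ c)].
Qed.

Lemma coordsK i y : uncoords i (coords i y) = y.
Proof.
apply: (@coords_inj i); apply: uncoordsK.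
by have : range (coords i) (coords i y) by []; rewrite range_coords => -[].
Qed.

Definition pstate i y : state G := (coords i y).1.
Definition plabel i y : cantor_space := (coords i y).2.

Lemma pstateP i y : restr_ultra (family i) (pstate i y).
Proof. by have : range (coords i) (coords i y) by []; rewrite range_coords => -[]. Qed.

Lemma pstate_near i y A : nbhs y [set x | pstate i x A = pstate i y A].
Proof.
have h : pstate i @ y --> pstate i y.
  by apply: cvg_comp (@coords_continuous i y) _; exact: cvg_fst.
exact: h (nbhs_state_coord (pstate i y) A).
Qed.

Lemma plabel_cvg i y : plabel i @ y --> plabel i y.
Proof. by apply: cvg_comp (@coords_continuous i y) _; exact: cvg_snd. Qed.

(** [coords i] is an embedding by compactness, so continuity of maps into the [i]-th space can be
    checked on states and labels. *)
Lemma coords_cvg (S : Type) (L : set_system S) i (f : S -> cantor_space) y :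
  Filter L -> coords i \o f @ L --> coords i y -> f @ L --> y.
Proof.
move=> FL; apply: continuous_inj_cvg.
- exact: cantor_space_compact.
- move=> [a b] [c d] h.
  congr pair.
    by apply: (cluster_continuous_eq (p := fst) (@state_hausdorff G) _ h) => u; exact: cvg_fst.
  by apply: (cluster_continuous_eq (p := snd) cantor_space_hausdorff _ h) => u; exact: cvg_snd.
- exact: coords_continuous.
- exact: coords_inj.
Qed.

Definition sys_act i (g : G) y : cantor_space :=
  uncoords i (state_act g (pstate i y), plabel i y).

Lemma coords_sys_act i g y :
  coords i (sys_act i g y) = (state_act g (pstate i y), plabel i y).
Proof.
apply: uncoordsK => /=; have [z uz <-] := pstateP i y.
rewrite -restr_act; last exact: family_admissible.
by exists (state_act g z) => //; exact: state_act_ultra.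
Qed.

(** The case [i = j] keeps the reflexive bond the identity; a strict bond restricts the state and
    resets the label to the zero sequence. *)
Definition sys_bond i j y : cantor_space :=
  if pselect (i = j) then y
  else uncoords i (restr (family i) (pstate j y), fun=> false).

Lemma sys_bond_id i y : sys_bond i i y = y.
Proof. by rewrite /sys_bond; case: pselect. Qed.

Lemma coords_sys_bond i j y : (i.2 < j.2)%N -> family i `<=` family j ->
  coords i (sys_bond i j y) = (restr (family i) (pstate j y), fun=> false).
Proof.
move=> ij Fij; rewrite /sys_bond; case: pselect => [e|ne] /=.
  by rewrite e ltnn in ij.
apply: uncoordsK => /=; have [z uz <-] := pstateP j y.
by rewrite restr_restr//; exists z.
Qed.

Lemma sys_act_continuous i :
  continuous (fun p : G * cantor_space => sys_act i p.1 p.2).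
Proof.
move=> [g y]; apply: (@coords_cvg _ _ i _ (sys_act i g y)); rewrite coords_sys_act.
rewrite (_ : coords i \o _ =
  (fun p : G * cantor_space => (state_act p.1 (pstate i p.2), plabel i p.2))); last first.
  by apply: funext => p; exact: coords_sys_act.
apply: cvg_to_pair; last first.
  by apply: cvg_comp _ (@plabel_cvg i y); exact: cvg_snd.
apply: prod_coord_cvg => A; apply: bool_cvg; rewrite /state_act.
have [_ uF _] := family_admissible i.
(* Outside the algebra no translate of [A] lies in [family i], so all values are [false]. Inside it,
   [ltrans h A] does not change for [h] near [g]. *)
have [uA|nA] := pselect (uclopen A); last first.
  apply: filterS filterT => -[h x] _ /=.
  have N (k : G) x' : pstate i x' (ltrans k A) = false.
    have [z _ <-] := pstateP i x'; rewrite restrN// => /uF.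
    by rewrite uclopen_ltransE.
  by rewrite !N.
exists ([set h | ltrans h A = ltrans g A],
        [set x | pstate i x (ltrans g A) = pstate i y (ltrans g A)]).
  by split; [exact: near_ltrans_eq|exact: pstate_near].
by move=> [h x] /= [-> ->].
Qed.

Lemma sys_is_gaction i : is_gaction (sys_act i).
Proof.
split; last exact: sys_act_continuous.
- move=> y; apply: (@coords_inj i); rewrite coords_sys_act.
  rewrite [RHS]surjective_pairing; congr pair.
  apply: functional_extensionality_dep => A; rewrite /state_act.
  congr pstate; apply: funext => t.
  by rewrite /ltrans /= tg_mul1g.
- move=> g h y; apply: (@coords_inj i); rewrite !coords_sys_act /pstate /plabel.
  rewrite coords_sys_act; congr pair.
  apply: functional_extensionality_dep => A; rewrite /state_act.
  congr pstate; apply: funext => t.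
  by rewrite /ltrans /= tg_mulA.
Qed.

Lemma sys_bond_continuous i j : index_le i j -> continuous (sys_bond i j).
Proof.
move=> [<-|[ij Fij]] y.
  rewrite (_ : sys_bond i i = id); first exact: cvg_id.
  by apply: funext => x; exact: sys_bond_id.
apply: (@coords_cvg _ _ i _ (sys_bond i j y)); rewrite coords_sys_bond//.
rewrite (_ : coords i \o _ =
  (fun y => (restr (family i) (pstate j y), fun=> false))); last first.
  by apply: funext => x; exact: coords_sys_bond.
apply: cvg_to_pair; last exact: cvg_cst.
by apply: restr_cvg => A _; exact: pstate_near.
Qed.

Lemma sys_bond_act i j g y : index_le i j ->
  sys_bond i j (sys_act j g y) = sys_act i g (sys_bond i j y).
Proof.
move=> [<-|[ij Fij]]; first by rewrite !sys_bond_id.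
apply: (@coords_inj i); rewrite coords_sys_bond// coords_sys_act.
rewrite /pstate /plabel coords_sys_bond// coords_sys_act /=.
by rewrite restr_act//; exact: family_admissible.
Qed.

Lemma sys_bond_comp i j k y : index_le i j -> index_le j k ->
  sys_bond i j (sys_bond j k y) = sys_bond i k y.
Proof.
move=> [<-|[ij Fij]]; first by rewrite sys_bond_id.
move=> [<-|[jk Fjk]]; first by rewrite sys_bond_id.
have ik := ltn_trans ij jk.
apply: (@coords_inj i); rewrite !coords_sys_bond//; last exact: subset_trans Fjk.
by rewrite /pstate coords_sys_bond//= restr_restr.
Qed.

(** The successor in the level makes [k] strictly larger even when [i = j], so that the bonds out of
    [k] collapse the labels. *)
Lemma index_above i j : exists k, [/\ (i.2 < k.2)%N, (j.2 < k.2)%N,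
  family i `<=` family k & family j `<=` family k].
Proof.
have aU := admissibleU (family_admissible i) (family_admissible j).
exists (exist _ _ aU, (maxn i.2 j.2).+1); split=> /=.
- by rewrite ltnS leq_maxl.
- by rewrite ltnS leq_maxr.
- by move=> A; left.
- by move=> A; right.
Qed.

Lemma sys_inverse_system : gspace_inverse_system index_le
  (X := fun=> cantor_space) sys_act sys_bond.
Proof.
split.
- split.
  + exact: (inhabits (exist _ _ (admissible0 G), 0%N)).
  + by move=> i; left.
  + move=> i j k [->//|[ij Fij]] [<-|[jk Fjk]]; first by right.
    by right; split; [exact: ltn_trans jk|exact: subset_trans Fjk].
  + by move=> i j; have [k [ik jk Fik Fjk]] := index_above i j; exists k; split; right.
- exact: sys_is_gaction.
- move=> i j ij; split; first exact: sys_bond_continuous.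
  by move=> g x; exact: sys_bond_act.
- split; first exact: sys_bond_id.
  by move=> i j k ij jk x; exact: sys_bond_comp.
Qed.

(** * Points of the inverse limit as ultrafilters *)

Local Notation limit := (inverse_limit index_le (X := fun=> cantor_space) sys_bond).

(** The existential avoids choosing an index: a state is [false] off its family, so indices whose
    family omits [A] contribute nothing. *)
Definition glue (x : index -> cantor_space) : state G :=
  fun A => `[< exists i, pstate i (x i) A >].

(** Every coordinate of a thread is the image of one at a strictly larger index, so its label is
    zero. The extra Cantor factor thereby vanishes from the limit. *)
Lemma limit_restr x i j : limit x -> (i.2 < j.2)%N -> family i `<=` family j ->
  coords i (x i) = (restr (family i) (pstate j (x j)), fun=> false).
Proof. by move=> lx ij Fij; rewrite -(lx i j) ?coords_sys_bond//; right. Qed.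

(** Two indices whose families contain [A] are compared at a common strict upper bound. *)
Lemma glueE x i A : limit x -> family i A -> glue x A = pstate i (x i) A.
Proof.
move=> lx iA; apply/asboolP/idP => [[j jA]|]; last by exists i.
have jF : family j A.
  have [z _ zj] := pstateP j (x j); apply: contrapT => nF.
  by move: jA; rewrite -zj restrN.
have [k [ik jk Fik Fjk]] := index_above i j.
move: jA; rewrite /pstate (limit_restr lx ik Fik) (limit_restr lx jk Fjk) /=.
by rewrite !restrE.
Qed.

Lemma glueN x A : ~ uclopen A -> glue x A = false.
Proof.
move=> nA; apply/asboolP => -[j]; have [z _ <-] := pstateP j (x j).
have [_ uF _] := family_admissible j.
by rewrite restrN// => /uF.
Qed.

Lemma limit_coords x i : limit x ->
  coords i (x i) = (restr (family i) (glue x), fun=> false).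
Proof.
move=> lx; have [k [ik _ Fik _]] := index_above i i.
rewrite (limit_restr lx ik Fik); congr pair.
apply: functional_extensionality_dep => A.
have [iA|nA] := pselect (family i A); last by rewrite !restrN.
by rewrite !restrE// (@glueE _ k)//; exact: Fik.
Qed.

Hypothesis sepG : separable_space G.
Hypothesis naG : non_archimedean G.

(** Separability enters through the countable orbit of [A]: the admissible families exhaust the
    algebra. *)
Lemma index_containing A : uclopen A -> exists i, family i A.
Proof.
move=> uA; exists (exist _ _ (admissible_orbit sepG uA), 0%N).
exact: orbit_refl.
Qed.

(** Each axiom concerns at most three sets of the algebra. By directedness they lie in one family,
    where the glued state agrees with a genuine ultrafilter. *)
Lemma glue_ultra x : limit x -> ultra (glue x).
Proof.
move=> lx.
have H A B C : uclopen A -> uclopen B -> uclopen C -> exists2 z, ultra z &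
    [/\ glue x A = z A, glue x B = z B & glue x C = z C].
  move=> /index_containing[i iA] /index_containing[j jB] /index_containing[l lC].
  have [k [_ _ Fik Fjk]] := index_above i j.
  have [m [_ _ Fkm Flm]] := index_above k l.
  have [z uz zE] := pstateP m (x m); exists z => //.
  have mA := Fkm _ (Fik _ iA); have mB := Fkm _ (Fjk _ jB); have mC := Flm _ lC.
  by rewrite (glueE lx mA) (glueE lx mB) (glueE lx mC) -zE !restrE.
have u0 := uclopen0 G.
split=> [|A uA|A B uA uB|A nA]; last exact: glueN.
- by have [z [z0 _ _ _] [-> _ _]] := H _ _ _ u0 u0 u0.
- have [z [_ zC _ _] [-> -> _]] := H _ _ _ (uclopenC uA) uA u0.
  exact: zC.
- have [z [_ _ zI _] [-> -> ->]] := H _ _ _ (uclopenI uA uB) uA uB.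
  exact: zI.
Qed.

(** * The isomorphism between the greatest ambit and the limit *)

Definition to_limit (phi : ambit_space G) : prod_topology (fun _ : index => cantor_space) :=
  fun i => uncoords i (restr (family i) (char_state phi), fun=> false).

Lemma coords_to_limit phi i : is_character phi ->
  coords i (to_limit phi i) = (restr (family i) (char_state phi), fun=> false).
Proof.
move=> cphi; apply: uncoordsK; exists (char_state phi) => //.
exact: char_state_ultra.
Qed.

Lemma to_limitP phi : is_character phi -> limit (to_limit phi).
Proof.
move=> cphi i j [<-|[ij Fij]]; first exact: sys_bond_id.
apply: (@coords_inj i); rewrite coords_sys_bond// /pstate !coords_to_limit//=.
by rewrite restr_restr.
Qed.

Lemma glue_to_limit phi : is_character phi -> glue (to_limit phi) = char_state phi.
Proof.
move=> cphi; apply: functional_extensionality_dep => A.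
have [uA|nA] := pselect (uclopen A); last first.
  by have [_ _ _ ->] := char_state_ultra cphi; rewrite ?glueN.
have [i iA] := index_containing uA.
rewrite (glueE (to_limitP cphi) iA) /pstate coords_to_limit//=.
by rewrite restrE.
Qed.

(** Characters take only the values 0 and 1 on these indicators, so values at distance less than 1
    coincide. *)
Lemma char_state_near phi A : is_character phi -> uclopen A ->
  within (greatest_ambit G) (nbhs phi) [set psi | char_state psi A = char_state phi A].
Proof.
move=> cphi uA; pose f : RUCB G := exist _ _ (rucb_indf uA).
have h : (fun psi : ambit_space G => psi f) @ phi --> (phi f : CC).
  exact: (@prod_coord_continuous _ (fun _ : RUCB G => CC) f phi).
have /cvg_CCP/(_ 1 ltr01) := h; apply: filterS => psi /= near cpsi.
rewrite !char_stateE// -[indf A]/(sval f) !char_onE.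
move: near; rewrite -!char_onE /=.
have [->|->] := char_on_indf_idem cphi uA; have [->|->] := char_on_indf_idem cpsi uA => //.
  by rewrite subr0 normr1 ltxx.
by rewrite sub0r normrN normr1 ltxx.
Qed.

Lemma to_limit_continuous : {within greatest_ambit G, continuous to_limit}.
Proof.
apply/subspace_continuousP => phi cphi; apply: prod_coord_cvg => i.
apply: (@coords_cvg _ _ i _ (to_limit phi i)); rewrite coords_to_limit//.
(* The formula for the coordinates is available for characters, so the two functions are compared
   within the ambit. *)
have e : {near within (greatest_ambit G) (nbhs phi),
    (fun psi => (restr (family i) (char_state psi), fun=> false)) =1
    coords i \o (to_limit ^~ i)}.
  apply: (@filterS _ (nbhs phi) _ setT) filterT => psi _ /= cpsi.
  by rewrite coords_to_limit.
apply: cvg_trans (near_eq_cvg e) _.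
apply: (@cvg_to_pair (state G) cantor_space _ _
  (fun psi => restr (family i) (char_state psi)) (fun=> fun=> false)); last exact: cvg_cst.
apply: (@restr_cvg _ _ _ _ (@char_state G)) => A iA; apply: char_state_near => //.
by have [_ uF _] := family_admissible i; exact: uF.
Qed.

(** Some [A] in the ultrafilter of [x] has [f] within $e/2$ of its limit throughout. Nearby threads
    also contain [A], so their limits of [f] can be compared with that of [x] at a common point of
    [A]. *)
Lemma state_char_glue_continuous :
  {within limit, continuous (fun x : prod_topology (fun _ : index => cantor_space) =>
                               state_char (glue x))}.
Proof.
apply/subspace_continuousP => x lx; apply: prod_coord_cvg => f.
apply/cvg_CCP => e e0; have e20 : 0 < e / 2 by rewrite divr_gt0.
have ux := glue_ultra lx; have PF := state_filter_proper ux.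
have /cvg_CCP/(_ _ e20)[A [uA gA Ac]] := state_char_cvg naG (f := f) ux.
have [i iA] := index_containing uA.
have h : (fun y : prod_topology (fun _ : index => cantor_space) => y i) @ x --> x i.
  exact: (@prod_coord_continuous _ (fun _ : index => cantor_space) i x).
have hx : nbhs x [set y : prod_topology (fun _ : index => cantor_space) |
    pstate i (y i) A = pstate i (x i) A] := h _ (pstate_near i (x i) A).
apply: filterS hx => y /= yx ly.
have uy := glue_ultra ly; have PFy := state_filter_proper uy.
have /cvg_CCP/(_ _ e20) yc := state_char_cvg naG (f := f) uy.
have Ay : state_filter (glue y) A.
  by exists A; split=> //; rewrite (glueE ly iA) yx -(glueE lx iA).
have [g [/Ac /= gx /= gy]] := filter_ex (filterI Ay yc).
suff : `|state_char (glue y) f - state_char (glue x) f| < e by [].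
rewrite -(subrK (sval f g) (state_char (glue y) f)) -addrA.
by rewrite (le_lt_trans (ler_normD _ _))// [ltRHS]splitr ltrD// distrC.
Qed.

Lemma sys_ambit_iso_limit : ambit_iso_limit (G := G) index_le
  (X := fun=> cantor_space) sys_act sys_bond.
Proof.
exists to_limit, (fun x => state_char (glue x)); split; [split|..].
- exact: to_limitP.
- by move=> x lx; apply: state_char_character => //; exact: glue_ultra.
- by move=> phi cphi; rewrite glue_to_limit// char_stateK.
- move=> x lx; apply: functional_extensionality_dep => i.
  by rewrite /to_limit (state_charK naG (glue_ultra lx)) -(limit_coords i lx) coordsK.
- exact: to_limit_continuous.
- exact: state_char_glue_continuous.
- move=> g phi cphi; apply: functional_extensionality_dep => i.
  have ug := state_act_ultra g (char_state_ultra cphi).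
  have LE : coords i (to_limit (ambit_act g phi) i) =
      (restr (family i) (state_act g (char_state phi)), fun=> false).
    by rewrite /to_limit char_state_act uncoordsK//; exists (state_act g (char_state phi)).
  apply: (@coords_inj i); rewrite LE [RHS]coords_sys_act /pstate /plabel coords_to_limit//=.
  by rewrite restr_act//; exact: family_admissible.
Qed.

End InverseSystem.

Theorem theorem2p2p14 (G : topGroup) :
  polish_group G -> non_archimedean G ->
  (exists (I : Type) (le : I -> I -> Prop) (X : I -> topologicalType)
          (act : forall i, G -> X i -> X i) (bond : forall i j, X j -> X i),
     [/\ gspace_inverse_system le act bond,
         (forall i, [/\ compact [set: X i], metrizable (X i)
                      & covering_dim_zero (X i)]) &
         ambit_iso_limit le act bond]) /\
  (infinite_set [set: G] ->
   exists (I : Type) (le : I -> I -> Prop) (X : I -> topologicalType)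
          (act : forall i, G -> X i -> X i) (bond : forall i j, X j -> X i),
     [/\ gspace_inverse_system le act bond,
         (forall i, [/\ compact [set: X i], metrizable (X i)
                      & covering_dim_zero (X i)]),
         (forall i, homeomorphic (X i) cantor_space) &
         ambit_iso_limit le act bond]).
Proof.
move=> [sepG _] naG.
have sys := sys_inverse_system G.
have iso := sys_ambit_iso_limit sepG naG.
have dim0 (i : index G) : [/\ compact [set: cantor_space], metrizable cantor_space
    & covering_dim_zero cantor_space].
  split; [exact: cantor_space_compact|exact: cantor_metrizable|].
  exact: cantor_covering_dim_zero.
(* One system proves both claims, since each of its spaces is the Cantor space itself. *)
split=> [|_]; exists (index G), (@index_le G), (fun=> cantor_space), (@sys_act G),
  (@sys_bond G); split=> // i.
by exists id, id; split=> // x; exact: cvg_id.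
Qed.
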